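(* Suppose $X$ has a minimum or a maximum, and let $Y$ be a subset of $X$ (not necessarily convex) with a minimum and a maximum such that $X$ is order-isomorphic to a subset of $Y$. Then $\operatorname{rank}(\mathcal{OP}(X,Y):\mathcal{O}(X,Y))=1$.
   Context: Maps are written on the right of their arguments and composed from left to right. Throughout, $X$ is an infinite linearly ordered set that is dense (for all $x<y$ in $X$ there is $z\in X$ with $x<z<y$). A subset $C\subseteq X$ is convex if $x,y\in C$, $z\in X$ and $x<z<y$ imply $z\in C$; an open convex subset of $X$ is a nonempty convex subset of $X$ having neither a minimum nor a maximum. For sets, $A<B$ means $a<b$ for all $a\in A$, $b\in B$. It is assumed that $X$ satisfies: (a) if $X=X'\cup X''$ with $X'<X''$ and $X',X''\neq\emptyset$, then $X'$ has a maximum or $X''$ has a minimum; (b) any two open convex subsets of $X$ are order-isomorphic. Two subchains are order-isomorphic if there is an order-preserving bijection between them. $\mathcal{T}(X)$ is the monoid of all maps $X\to X$ under composition, and $\mathcal{O}(X)$ is its submonoid of order-preserving maps ($x\le y$ implies $x\alpha\le y\alpha$). A map $\alpha\in\mathcal{T}(X)$ is orientation-preserving if there is a nonempty subset $X_1\subseteq X$ such that, with $X_2=X\setminus X_1$: (1) $\alpha$ is order-preserving on $X_1$ and on $X_2$; and (2) for all $p\in X_1$ and $q\in X_2$, $p<q$ and $p\alpha\ge q\alpha$. $\mathcal{OP}(X)$ is the monoid of all orientation-preserving maps on $X$. For a nonempty $Y\subseteq X$, $\mathcal{O}(X,Y)=\{\alpha\in\mathcal{O}(X):\operatorname{im}\alpha\subseteq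 Y\}$ and $\mathcal{OP}(X,Y)=\{\alpha\in\mathcal{OP}(X):\operatorname{im}\alpha\subseteq Y\}$; these are semigroups with $\mathcal{O}(X,Y)\subseteq\mathcal{OP}(X,Y)$. For a semigroup $S$ and $A\subseteq S$, the relative rank $\operatorname{rank}(S:A)$ is the minimal cardinality of a set $B\subseteq S$ such that $A\cup B$ generates $S$. *)

(* Defs.v *)
From mathcomp Require Import all_boot all_order.
From mathcomp Require Import all_classical.

Set Implicit Arguments.
Unset Strict Implicit.
Unset Printing Implicit Defensive.

Local Open Scope order_scope.
Local Open Scope classical_set_scope.
Local Open Scope card_scope.

Definition has_min (d : Order.disp_t) (X : orderType d) (A : set X) : Prop :=
  exists2 m, A m & lbound A m.

Definition has_max (d : Order.disp_t) (X : orderType d) (A : set X) : Prop :=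
  exists2 m, A m & ubound A m.

Definition dense_order (d : Order.disp_t) (X : orderType d) : Prop :=
  forall x y : X, x < y -> exists z : X, x < z < y.

Definition convex_subset (d : Order.disp_t) (X : orderType d) (C : set X) : Prop :=
  forall x y z : X, C x -> C y -> x < z < y -> C z.

Definition open_convex (d : Order.disp_t) (X : orderType d) (C : set X) : Prop :=
  [/\ convex_subset C, C !=set0, ~ has_min C & ~ has_max C].

Definition set_lt (d : Order.disp_t) (X : orderType d) (A B : set X) : Prop :=
  forall a b : X, A a -> B b -> a < b.

(* The bijection is a total function of which only the restriction to A
   matters. *)
Definition order_isomorphic (d : Order.disp_t) (X : orderType d)
    (A B : set X) : Prop :=
  exists2 f : X -> X, set_bij A B f & {in A &, {homo f : x y / x <= y}}.

Definition no_gaps (d : Order.disp_t) (X : orderType d) : Prop :=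
  forall A B : set X, A `|` B = [set: X] -> set_lt A B ->
    A !=set0 -> B !=set0 -> has_max A \/ has_min B.

Definition open_convex_isomorphic (d : Order.disp_t) (X : orderType d) : Prop :=
  forall A B : set X, open_convex A -> open_convex B -> order_isomorphic A B.

Definition orientation_preserving (d : Order.disp_t) (X : orderType d)
    (f : X -> X) : Prop :=
  exists X1 : set X,
    [/\ X1 !=set0,
        {in X1 &, {homo f : x y / x <= y}},
        {in ~` X1 &, {homo f : x y / x <= y}} &
        forall p q : X, X1 p -> (~` X1) q -> p < q /\ f q <= f p].

Definition O_XY (d : Order.disp_t) (X : orderType d) (Y : set X) : set (X -> X) :=
  [set f | {homo f : x y / x <= y} /\ range f `<=` Y].

Definition OP_XY (d : Order.disp_t) (X : orderType d) (Y : set X) : set (X -> X) :=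
  [set f | orientation_preserving f /\ range f `<=` Y].

(* Maps act on the right: the product of f and g is "first f, then g". *)
Definition map_mul (X : Type) (f g : X -> X) : X -> X := g \o f.

Definition mul_closed (M : Type) (mul : M -> M -> M) (A : set M) : Prop :=
  forall a b : M, A a -> A b -> A (mul a b).

Definition generated (M : Type) (mul : M -> M -> M) (G : set M) : set M :=
  smallest (mul_closed mul) G.

(* rank (S : A) = |K|, for S a subsemigroup of (M, mul): a cardinal is given by
   a set K having that cardinality, so that infinite ranks are covered too. *)
Definition is_relative_rank (M : Type) (mul : M -> M -> M) (S A : set M)
    (U : Type) (K : set U) : Prop :=
  let generating B := B `<=` S /\ generated mul (A `|` B) = S in
  (exists2 B, generating B & B #= K) /\
  (forall B, generating B -> K #<= B).

(* Main.v *)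
Require Import Defs.
From mathcomp Require Import all_boot all_order.
From mathcomp Require Import all_classical.

Set Implicit Arguments.
Unset Strict Implicit.
Unset Printing Implicit Defensive.
Import Order.TTheory.

Local Open Scope order_scope.
Local Open Scope classical_set_scope.

(** A map [f] which preserves the orientation without being order-preserving
    cuts the chain into a first block and a second block and sends the second
    block below the first one. Choose two disjoint intervals of [X]. The interior
    of [X] is isomorphic to the interior of either of them, so [X] embeds into
    both, and composing with an embedding of [X] into [Y] gives two copies
    [J1 < J2] of [X] inside [Y]. A single orientation-preserving map [c] with
    values in [Y] exchanges the two copies ([exchange_map]), and [f = b c e],
    where [b] sends the first block into the low copy and the second block into
    the high copy, and [e] reads off the values of [f]
    ([exchange_factorization]). Hence [c] together with the order-preserving
    maps generates everything. No generator can be spared: the order-preserving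
    maps are closed under composition and [c] is not one of them.

    The maps [c] and [e] are at first defined on copies of convex parts of [X]
    only, and must be extended to [X] with values in [Y], which need not be
    complete. This is possible since [X] itself is complete: in each gap of an
    embedded copy of [X] the value at an endpoint of the gap can be repeated, and
    outside the copy the minimum and the maximum of [Y] are used
    ([extension_along_embedding]). For [e] there remains the gap between the
    values on the second block and those on the first one. A least or a greatest
    element of [X] takes under [f] a value which lies there
    ([orientation_preserving_separated]). *)

(** * Orientation-preserving maps *)

Section Orientation.
Context (d : Order.disp_t) (X : orderType d).
Implicit Types (f g : X -> X) (A : set X).

(** [f] is order-preserving on [A]. *)
Definition mono_on A f : Prop :=
  forall x y, A x -> A y -> x <= y -> f x <= f y.

Lemma mono_onP A f : {in A &, {homo f : x y / x <= y}} <-> mono_on A f.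
Proof.
split=> [fA x y Ax Ay | fA x y /set_mem Ax /set_mem Ay]; last exact: fA.
by apply: fA; rewrite inE.
Qed.

(** The first block may be empty, for then the whole chain can serve as the
    first block. *)
Lemma orientation_preserving_cut (x0 : X) A f :
    mono_on A f -> mono_on (~` A) f ->
    (forall p q, A p -> ~ A q -> p < q /\ f q <= f p) ->
  orientation_preserving f.
Proof.
move=> fA fnA cutA; have [[a Aa]|A0] := pselect (A !=set0).
  by exists A; split; [exists a | apply/mono_onP | apply/mono_onP | ].
exists setT; split; first by exists x0.
- apply/mono_onP => x y _ _.
  by apply: fnA => ?; apply: A0; [exists x | exists y].
- by apply/mono_onP => x y [].
- by move=> p q _ [].
Qed.

Lemma homo_orientation_preserving (x0 : X) f :
  {homo f : x y / x <= y} -> orientation_preserving f.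
Proof.
move=> fh; apply: (@orientation_preserving_cut x0 setT).
- by move=> x y _ _; apply: fh.
- by move=> x y [].
- by move=> p q _ [].
Qed.

(** Of the four pieces into which the cuts of [f] and [g] divide the chain one
    is empty; if it belongs to the second block of [f], the composite is cut
    inside the first block of [f], and otherwise inside the second one. *)
Lemma orientation_preserving_comp f g :
  orientation_preserving f -> orientation_preserving g ->
  orientation_preserving (g \o f).
Proof.
move=> [A [[a0 Aa0] /mono_onP fA /mono_onP fnA cutA]].
move=> [B [_ /mono_onP gB /mono_onP gnB cutB]].
have [AB|nAB] := pselect (exists2 p, A p & B (f p)).
- have nAfB q : ~ A q -> B (f q).
    move=> nAq; apply: contrapT => nBq; case: AB => p Ap Bp.
    have [lt_pq _] := cutB _ _ Bp nBq; have [_ le_qp] := cutA _ _ Ap nAq.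
    by move: (lt_le_trans lt_pq le_qp); rewrite ltxx.
  have eqA q : ~ (A q /\ B (f q)) -> B (f q) -> ~ A q by move=> h Bq Aq; apply: h.
  apply: (@orientation_preserving_cut a0 [set x | A x /\ B (f x)]).
  + by move=> x y [Ax Bx] [Ay By] xy; apply: gB => //; apply: fA.
  + move=> x y nx ny xy /=.
    have [Bx|nBx] := pselect (B (f x)); have [By|nBy] := pselect (B (f y)).
    * by apply: gB => //; apply: fnA => //; apply: eqA.
    * have nAx := eqA _ nx Bx.
      have Ay : A y by apply: contrapT => /nAfB.
      by have [] := cutA _ _ Ay nAx; rewrite ltNge xy.
    * by have [] := cutB _ _ By nBx.
    * have Ax : A x by apply: contrapT => /nAfB.
      have Ay : A y by apply: contrapT => /nAfB.
      by apply: gnB => //; apply: fA.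
  + move=> p q [Ap Bp] nq; have [Bq|nBq] := pselect (B (f q)).
      have [pq fqp] := cutA _ _ Ap (eqA _ nq Bq).
      by split=> //; apply: gB.
    have Aq : A q by apply: contrapT => /nAfB.
    have [pq gqp] := cutB _ _ Bp nBq; split=> //.
    by rewrite ltNge; apply/negP => /(fA _ _ Aq Ap); rewrite leNgt pq.
- have AfnB p : A p -> ~ B (f p) by move=> Ap Bp; apply: nAB; exists p.
  have nBA q : B (f q) -> ~ A q by move=> Bq /AfnB.
  apply: (@orientation_preserving_cut a0 [set x | A x \/ B (f x)]).
  + move=> x y [Ax|Bx] [Ay|By] xy /=.
    * by apply: gnB; [apply: AfnB | apply: AfnB | apply: fA].
    * by have [] := cutB _ _ By (AfnB _ Ax).
    * by have [] := cutA _ _ Ay (nBA _ Bx); rewrite ltNge xy.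
    * by apply: gB => //; apply: fnA => //; apply: nBA.
  + move=> x y /not_orP[nAx nBx] /not_orP[nAy nBy] xy.
    by apply: gnB => //; apply: fnA.
  + move=> p q Hp /not_orP[nAq nBq]; have [Ap|nAp] := pselect (A p).
      have [pq fqp] := cutA _ _ Ap nAq.
      by split=> //; apply: gnB => //; apply: AfnB.
    case: Hp => // Bp; have [pq gqp] := cutB _ _ Bp nBq; split=> //.
    by rewrite ltNge; apply/negP => /(fnA _ _ nAq nAp); rewrite leNgt pq.
Qed.

Lemma O_XY_mul_closed (Y : set X) : mul_closed (@map_mul X) (O_XY Y).
Proof.
move=> f g [fh fY] [gh gY]; split=> [x y xy | _ [x _ <-]].
  by apply: gh; apply: fh.
by apply: gY; exists (f x).
Qed.

Lemma OP_XY_mul_closed (Y : set X) : mul_closed (@map_mul X) (OP_XY Y).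
Proof.
move=> f g [fop fY] [gop gY]; split; first exact: orientation_preserving_comp.
by move=> _ [x _ <-]; apply: gY; exists (f x).
Qed.

End Orientation.

(** * Embeddings of the chain and extension of maps along them *)

Section Chain.
Context (d : Order.disp_t) (X : orderType d).
Implicit Types (f g J : X -> X) (D Y : set X).

Lemma infinite_lt : infinite_set [set: X] -> exists x y : X, x < y.
Proof.
move=> Xinf; have [x _] := infinite_setN0 Xinf.
have /infinite_setN0 [y [_ yx]] : infinite_set ([set: X] `\ x).
  exact: infinite_setD.
have [xy|yx'|xy] := ltgtP x y; [by exists x, y | by exists y, x | ].
by case: yx; rewrite xy.
Qed.

Lemma dense_interval_open_convex (X_dense : dense_order X) (a b : X) :
  a < b -> open_convex [set x | a < x < b].
Proof.
move=> ab; split.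
- move=> x y z /= /andP[ax _] /andP[_ yb] /andP[xz zy].
  by rewrite (lt_trans ax xz) (lt_trans zy yb).
- by have [z zab] := X_dense _ _ ab; exists z.
- move=> [m /= /andP[am mb] mlb]; have [z /andP[az zm]] := X_dense _ _ am.
  have /mlb : [set x | a < x < b] z by rewrite /= az (lt_trans zm mb).
  by rewrite leNgt zm.
- move=> [m /= /andP[am mb] mub]; have [z /andP[mz zb]] := X_dense _ _ mb.
  have /mub : [set x | a < x < b] z by rewrite /= zb (lt_trans am mz).
  by rewrite leNgt mz.
Qed.

(** The chain deprived of its extrema. *)
Definition inner : set X := [set x | (exists y, y < x) /\ (exists y, x < y)].

Lemma inner_open_convex (X_infinite : infinite_set [set: X])
  (X_dense : dense_order X) : open_convex inner.
Proof.
split.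
- by move=> x y z _ _ /andP[xz zy]; split; [exists x | exists y].
- have [x [y /X_dense[z /andP[xz zy]]]] := infinite_lt X_infinite.
  by exists z; split; [exists x | exists y].
- move=> [m [[y ym] [u mu]] mlb]; have [z /andP[yz zm]] := X_dense _ _ ym.
  have /mlb : inner z by split; [exists y | exists m].
  by rewrite leNgt zm.
- move=> [m [[y ym] [u mu]] mub]; have [z /andP[mz zu]] := X_dense _ _ mu.
  have /mub : inner z by split; [exists m | exists u].
  by rewrite leNgt mz.
Qed.

Lemma order_isomorphic_strict (A B : set X) : order_isomorphic A B ->
  exists f, (forall x, A x -> B (f x)) /\
            (forall x y, A x -> A y -> x < y -> f x < f y).
Proof.
move=> [f [fAB finj _] /mono_onP fh]; exists f; split; first exact: fAB.
move=> x y Ax Ay xy; rewrite lt_neqAle (fh _ _ Ax Ay (ltW xy)) andbT.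
apply/eqP => fxy; have xey : x = y by apply: finj; rewrite ?inE.
by rewrite xey ltxx in xy.
Qed.

(** An isomorphism of the interior onto an open interval extends to the
    extrema, which go to the endpoints. *)
Lemma embedding_in_interval (X_infinite : infinite_set [set: X])
    (X_dense : dense_order X) (X_open_convex : open_convex_isomorphic X)
    (a b : X) : a < b ->
  exists2 f : X -> X, {homo f : x y / x < y} & forall x, a <= f x <= b.
Proof.
move=> ab; have [f [fab fh]] := order_isomorphic_strict
  (X_open_convex _ _ (inner_open_convex X_infinite X_dense)
                     (dense_interval_open_convex X_dense ab)).
pose g x := if `[< inner x >] then f x
            else if `[< exists y, y < x >] then b else a.
exists g; last first.
  move=> x; rewrite /g; case: asboolP => [/fab/andP[ax xb]|_].
    by rewrite !ltW.
  by case: asboolP => _; rewrite lexx (ltW ab).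
move=> x y xy; rewrite /g.
have ylow : exists z, z < y by exists x.
case: (asboolP (inner y)) => [iy|niy]; case: (asboolP (inner x)) => [ix|nix].
- exact: fh.
- case: asboolP => [xlow|_]; last by have /andP[] := fab _ iy.
  by case: nix; split=> //; exists y.
- by case: asboolP => // _; have /andP[] := fab _ ix.
- case: (asboolP (exists z, z < x)) => [xlow|_]; last by case: asboolP.
  by case: nix; split=> //; exists y.
Qed.

(** A map prescribed on the image of an embedding [J] of a convex set extends,
    because completeness of the chain leaves every gap of that image with an
    endpoint which is the image of a point, whose value fills the gap; the
    bounds [u] and [v] are used outside the image. *)
Lemma extension_along_embedding (X_no_gaps : no_gaps X) J D f Y (u v : X) :
    {homo J : x y / x < y} -> convex_subset D -> mono_on D f ->
    Y u -> Y v -> u <= v -> (forall x, D x -> Y (f x) /\ u <= f x <= v) ->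
  exists g, [/\ {homo g : x y / x <= y}, forall z, Y (g z),
                forall z, u <= g z <= v & forall x, D x -> g (J x) = f x].
Proof.
move=> Jh Dconv fD Yu Yv uv fuv.
have Jle x y : (J x <= J y) = (x <= y).
  by apply/idP/idP; [apply: contraTT; rewrite -!ltNge; apply: Jh | exact: ltW_homo].
(* admissible values at z; the condition depends only on the place of z
   among the images of the points of D, which is what makes the choice monotone *)
pose R z := [set y | [/\ Y y, u <= y <= v,
  forall x, D x -> J x <= z -> f x <= y &
  forall x, D x -> z <= J x -> y <= f x]].
have Rex z : exists y, R z y.
  have [[c [Dc zc]]|C0] := pselect (exists c, D c /\ z = J c).
    have [Yc cuv] := fuv _ Dc.
    exists (f c); split=> //; move=> x Dx; rewrite zc Jle; exact: fD.
  have [[a [Da az]]|A0] := pselect (exists a, D a /\ J a <= z); last first.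
    exists u; split=> //; first by rewrite lexx uv.
      by move=> x Dx xz; case: A0; exists x.
    by move=> x /fuv[_ /andP[]].
  have [[b [Db zb]]|B0] := pselect (exists b, D b /\ z < J b); last first.
    exists v; split=> //; first by rewrite lexx uv.
      by move=> x /fuv[_ /andP[]].
    move=> x Dx; rewrite le_eqVlt => /orP[/eqP zx|zx]; first by case: C0; exists x.
    by case: B0; exists x.
  have ab : a < b by rewrite ltNge -Jle -ltNge (le_lt_trans az zb).
  have Dab s : a <= s <= b -> D s.
    move=> /andP[]; rewrite le_eqVlt => /orP[/eqP<-//|as'].
    rewrite le_eqVlt => /orP[/eqP->//|sb].
    by apply: (Dconv a b) => //; rewrite as'.
  have [|p q /= pz zq|||[s /= sz sub]|[s /= zs slb]] :=
      X_no_gaps [set x | J x <= z] [set x | z < J x].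
  - by apply/seteqP; split=> // x _; rewrite /setU /=; case: leP; [left|right].
  - by rewrite ltNge -Jle -ltNge (le_lt_trans pz zq).
  - by exists a.
  - by exists b.
  - have Ds : D s.
      apply: Dab; rewrite (sub _ az) /=.
      by rewrite -Jle (ltW (le_lt_trans sz zb)).
    have [Ys suv] := fuv _ Ds; exists (f s); split=> // x Dx xz.
      by apply: fD => //; apply: sub.
    by apply: fD => //; rewrite -Jle (le_trans sz xz).
  - have Ds : D s.
      apply: Dab; rewrite (slb _ zb) andbT.
      by rewrite -Jle (ltW (le_lt_trans az zs)).
    have [Ys suv] := fuv _ Ds; exists (f s); split=> // x Dx xz.
      by apply: fD => //; rewrite -Jle (le_trans xz (ltW zs)).
    apply: fD => //; apply: slb => /=; rewrite lt_neqAle xz andbT.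
    by apply/eqP => zx; apply: C0; exists x.
pose g z := xget u (R z).
have gR z : R z (g z) by exact: xgetPex (Rex z).
exists g; split=> [z z' zz'|z|z|x Dx].
- have [[x [Dx zx xz']]|noJ] :=
      pselect (exists x, [/\ D x, z <= J x & J x <= z']).
    have [_ _ _ gz] := gR z; have [_ _ gz' _] := gR z'.
    exact: le_trans (gz _ Dx zx) (gz' _ Dx xz').
  suff RR : R z = R z' by rewrite /g RR.
  have above x : D x -> z <= J x -> z' <= J x.
    by move=> Dx zx; rewrite leNgt; apply/negP => /ltW xz'; apply: noJ; exists x.
  have below x : D x -> J x <= z' -> J x <= z.
    by move=> Dx xz'; rewrite leNgt; apply/negP => /ltW zx; apply: noJ; exists x.
  apply/seteqP; split=> y [Yy yuv lo hi]; split=> // x Dx xz.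
  + by apply: lo => //; apply: below.
  + by apply: hi => //; apply: le_trans zz' xz.
  + by apply: lo => //; apply: le_trans xz zz'.
  + by apply: hi => //; apply: above.
- by have [] := gR z.
- by have [] := gR z.
- have [_ _ lo hi] := gR (J x).
  by apply/eqP; rewrite eq_le lo ?hi.
Qed.

(** Two order-preserving maps glued at [w]. *)
Definition glue (w : X) g h (z : X) : X := if z <= w then g z else h z.

Lemma glue_low w g h z : z <= w -> glue w g h z = g z.
Proof. by rewrite /glue => ->. Qed.

Lemma glue_high w g h z : w < z -> glue w g h z = h z.
Proof. by rewrite /glue leNgt => ->. Qed.

Lemma glue_homo w t g h :
    {homo g : x y / x <= y} -> {homo h : x y / x <= y} ->
    (forall z, g z <= t) -> (forall z, t <= h z) ->
  {homo glue w g h : x y / x <= y}.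
Proof.
move=> gh hh gt th x y xy; rewrite /glue.
case: (leP x w) => [xw|wx]; case: (leP y w) => [yw|wy].
- exact: gh.
- exact: le_trans (gt x) (th y).
- by move: (lt_le_trans wx (le_trans xy yw)); rewrite ltxx.
- exact: hh.
Qed.

Lemma glue_orientation_preserving w t g h :
    {homo g : x y / x <= y} -> {homo h : x y / x <= y} ->
    (forall z, t <= g z) -> (forall z, h z <= t) ->
  orientation_preserving (glue w g h).
Proof.
move=> gh hh tg ht; apply: (@orientation_preserving_cut _ _ w [set z | z <= w]).
- by move=> x y xw yw xy; rewrite !glue_low //; apply: gh.
- move=> x y /negP; rewrite -ltNge => wx /negP; rewrite -ltNge => wy xy.
  by rewrite !glue_high //; apply: hh.
- move=> p q pw /negP; rewrite -ltNge => wq; split; first exact: le_lt_trans wq.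
  by rewrite (glue_low _ _ pw) (glue_high _ _ wq); apply: le_trans (tg p).
Qed.

(** The value at an extremum of the chain separates the images of the two
    blocks, provided that neither block is empty. *)
Lemma orientation_preserving_separated (A : set X) f :
    has_min [set: X] \/ has_max [set: X] ->
    A !=set0 -> ~` A !=set0 -> mono_on A f -> mono_on (~` A) f ->
    (forall p q, A p -> ~ A q -> p < q /\ f q <= f p) ->
  exists e, (forall p, A p -> f e <= f p) /\ (forall q, ~ A q -> f q <= f e).
Proof.
move=> ext [p0 Ap0] [q0 nAq0] fA fnA cutA; case: ext => [] [e _ emax]; exists e.
- have Ae : A e.
    apply: contrapT => nAe; have [] := cutA _ _ Ap0 nAe.
    by rewrite ltNge emax.
  by split=> [p Ap | q nAq]; [apply: fA; rewrite // emax | case: (cutA _ _ Ae nAq)].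
- have nAe : ~ A e.
    by move=> Ae; have [] := cutA _ _ Ae nAq0; rewrite ltNge emax.
  by split=> [p Ap | q nAq]; [case: (cutA _ _ Ap nAe) | apply: fnA; rewrite // emax].
Qed.

(** Two copies of the chain inside [Y], one below the other, are exchanged by a
    single orientation-preserving map. *)
Lemma exchange_map (X_no_gaps : no_gaps X) Y J1 J2 (w : X) :
    has_min Y -> has_max Y -> Y w ->
    {homo J1 : x y / x < y} -> {homo J2 : x y / x < y} ->
    (forall x, Y (J1 x)) -> (forall x, Y (J2 x)) ->
    (forall x, J1 x <= w) -> (forall x, w < J2 x) ->
  exists2 c, OP_XY Y c & forall x, c (J1 x) = J2 x /\ c (J2 x) = J1 x.
Proof.
move=> [mY Ym mYP] [MY YM MYP] Yw J1h J2h YJ1 YJ2 J1w wJ2.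
have convT : convex_subset [set: X] by [].
have [g [gh gY gw gJ]] : exists g, [/\ {homo g : x y / x <= y},
    forall z, Y (g z), forall z, w <= g z <= MY &
    forall x, [set: X] x -> g (J1 x) = J2 x].
  apply: extension_along_embedding => //.
  - by move=> x y _ _; apply: (ltW_homo J2h).
  - exact: MYP.
  - by move=> x _; rewrite (ltW (wJ2 x)) MYP.
have [h [hh hY hw hJ]] : exists h, [/\ {homo h : x y / x <= y},
    forall z, Y (h z), forall z, mY <= h z <= w &
    forall x, [set: X] x -> h (J2 x) = J1 x].
  apply: extension_along_embedding => //.
  - by move=> x y _ _; apply: (ltW_homo J1h).
  - exact: mYP.
  - by move=> x _; rewrite J1w mYP.
exists (glue w g h).
  split; last by move=> _ [z _ <-]; rewrite /glue; case: ifP.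
  apply: (@glue_orientation_preserving w w) => // z.
    by have /andP[] := gw z.
  by have /andP[] := hw z.
by move=> x; rewrite glue_low ?glue_high ?gJ ?hJ.
Qed.

(** The first block is placed in the low copy and the second block in the high
    copy; after the exchange the blocks lie in the order of their images, and
    what remains to be done is order-preserving. *)
Lemma exchange_factorization (X_no_gaps : no_gaps X)
    (X_extremum : has_min [set: X] \/ has_max [set: X])
    Y J1 J2 (w : X) (c : X -> X) :
    has_min Y -> has_max Y ->
    {homo J1 : x y / x < y} -> {homo J2 : x y / x < y} ->
    (forall x, Y (J1 x)) -> (forall x, Y (J2 x)) ->
    (forall x, J1 x <= w) -> (forall x, w < J2 x) ->
    (forall x, c (J1 x) = J2 x /\ c (J2 x) = J1 x) ->
  forall f, OP_XY Y f -> O_XY Y f \/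
    exists b e, [/\ O_XY Y b, O_XY Y e & map_mul (map_mul b c) e = f].
Proof.
move=> [mY Ym mYP] [MY YM MYP] J1h J2h YJ1 YJ2 J1w wJ2 cJ f [fop fY].
have YF x : Y (f x) by apply: fY; exists x.
move: fop => [A [A0 /mono_onP fA /mono_onP fnA cutA]].
have [nA0|nA0] := pselect (~` A !=set0); last first.
  left; split=> // x y; apply: fA; apply: contrapT => nA; apply: nA0.
    by exists x.
  by exists y.
right.
have [s [sA snA]] :=
  orientation_preserving_separated X_extremum A0 nA0 fA fnA cutA.
have convA : convex_subset A.
  move=> x y z Ax Ay /andP[xz zy]; apply: contrapT => nAz.
  by have [] := cutA _ _ Ay nAz; rewrite ltNge (ltW zy).
have convnA : convex_subset (~` A).
  move=> x y z nAx nAy /andP[xz zy] Az.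
  by have [] := cutA _ _ Az nAx; rewrite ltNge (ltW xz).
have [g [gh gY gs gJ]] : exists g, [/\ {homo g : x y / x <= y},
    forall z, Y (g z), forall z, mY <= g z <= f s &
    forall x, (~` A) x -> g (J1 x) = f x].
  apply: extension_along_embedding => //; first exact: mYP.
  by move=> x nAx; rewrite snA // mYP.
have [h [hh hY hs hJ]] : exists h, [/\ {homo h : x y / x <= y},
    forall z, Y (h z), forall z, f s <= h z <= MY &
    forall x, A x -> h (J2 x) = f x].
  apply: extension_along_embedding => //; first exact: MYP.
  by move=> x Ax; rewrite sA // MYP.
pose b x := if `[< A x >] then J1 x else J2 x.
exists b, (glue w g h); split.
- split=> [x y xy|_ [x _ <-]]; rewrite /b; last by case: asboolP.
  case: asboolP => Ax; case: asboolP => Ay.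
  + exact: (ltW_homo J1h).
  + exact: le_trans (J1w x) (ltW (wJ2 y)).
  + by have [] := cutA _ _ Ay Ax; rewrite ltNge xy.
  + exact: (ltW_homo J2h).
- split; last by move=> _ [z _ <-]; rewrite /glue; case: ifP.
  apply: (@glue_homo w (f s)) => // z; first by have /andP[] := gs z.
  by have /andP[] := hs z.
- apply/funext => x; rewrite /map_mul /= /b; have [cJ1 cJ2] := cJ x.
  case: asboolP => Ax; first by rewrite cJ1 glue_high // hJ.
  by rewrite cJ2 glue_low // gJ.
Qed.

End Chain.

Local Close Scope order_scope.

Theorem theorem12 (d : Order.disp_t) (X : orderType d)
    (X_infinite : infinite_set [set: X])
    (X_dense : dense_order X)
    (X_no_gaps : no_gaps X)
    (X_open_convex : open_convex_isomorphic X)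
    (X_extremum : has_min [set: X] \/ has_max [set: X])
    (Y : set X)
    (Y_min : has_min Y)
    (Y_max : has_max Y)
    (X_into_Y : exists2 Z : set X, Z `<=` Y & order_isomorphic [set: X] Z) :
  is_relative_rank (@map_mul X) (OP_XY Y) (O_XY Y) `I_1.
Proof.
have [Z ZY /order_isomorphic_strict [iota [iotaZ iota_lt]]] := X_into_Y.
have iotaY x : Y (iota x) by apply/ZY/iotaZ.
have iotah : {homo iota : x y / (x < y)%O} by move=> x y; apply: iota_lt.
have [p1 [p4 p14]] := infinite_lt X_infinite.
have [p2 /andP[p12 p24]] := X_dense _ _ p14.
have [p3 /andP[p23 p34]] := X_dense _ _ p24.
have [f1 f1h f1P] :=
  embedding_in_interval X_infinite X_dense X_open_convex p12.
have [f2 f2h f2P] :=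
  embedding_in_interval X_infinite X_dense X_open_convex p34.
pose J1 x := iota (f1 x); pose J2 x := iota (f2 x); pose w := iota p2.
have J1h : {homo J1 : x y / (x < y)%O} by move=> x y /f1h/iotah.
have J2h : {homo J2 : x y / (x < y)%O} by move=> x y /f2h/iotah.
have J1w x : (J1 x <= w)%O by have /andP[_ /(ltW_homo iotah)] := f1P x.
have wJ2 x : (w < J2 x)%O.
  by apply: iotah; have /andP[p3f _] := f2P x; apply: lt_le_trans p3f.
have J1Y x : Y (J1 x) by exact: iotaY.
have J2Y x : Y (J2 x) by exact: iotaY.
have [c cOP cJ] :=
  exchange_map X_no_gaps Y_min Y_max (iotaY p2) J1h J2h J1Y J2Y J1w wJ2.
have OsubOP : O_XY Y `<=` OP_XY Y.
  move=> f [fh fY]; split=> //.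
  exact: (homo_orientation_preserving p1).
split.
- exists [set c]; last exact: card_set1.
  split; first by move=> _ ->.
  apply/seteqP; split.
    apply: smallest_sub; first exact: OP_XY_mul_closed.
    by move=> f [/OsubOP//|->].
  move=> f /(exchange_factorization X_no_gaps X_extremum Y_min Y_max
    J1h J2h J1Y J2Y J1w wJ2 cJ) fP B [Bmul BG].
  case: fP => [fO|[b [e [bO eO <-]]]]; first by apply: BG; left.
  by apply: (Bmul); [apply: (Bmul) |]; apply: BG; [left | right | left].
- move=> B [_ Bgen]; have [[g Bg]|B0] := pselect (B !=set0).
    rewrite -(card_le_eql (card_set1 (x := g))).
    by apply: subset_card_le => _ ->.
  have : generated (@map_mul X) (O_XY Y `|` B) c by rewrite Bgen.
  move=> /(_ (O_XY Y)) [].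
    split; first exact: O_XY_mul_closed.
    by move=> f [//|Bf]; case: B0; exists f.
  move=> ch _; have J12 := le_lt_trans (J1w p1) (wJ2 p1).
  by have := ch _ _ (ltW J12); have [-> ->] := cJ p1; rewrite leNgt J12.
Qed.
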